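(* Let $\alpha\in\mathbb R$ with $\alpha\le 2$. Then the polynomial $p(z_1,z_2)=2-z_1-z_2$ is cyclic in $\mathcal D_\alpha$.
   Context: $\mathbb D=\{z\in\mathbb C:|z|<1\}$. For $\alpha\in\mathbb R$, the Dirichlet-type space $\mathcal D_\alpha$ is the space of all holomorphic functions $f(z_1,z_2)=\sum_{k,l=0}^\infty a_{kl}z_1^kz_2^l$ on $\mathbb D^2$ with $\|f\|_\alpha^2:=\sum_{k,l=0}^\infty (k+l+1)^\alpha|a_{kl}|^2<\infty$; it is a Hilbert space with the corresponding inner product. A function $f\in\mathcal D_\alpha$ is cyclic in $\mathcal D_\alpha$ if the closed linear span in $\mathcal D_\alpha$ of $\{z_1^kz_2^l f: k,l\ge 0\}$ equals $\mathcal D_\alpha$. *)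

(* Defs.v *)
From HB Require Import structures.
From mathcomp Require Import all_boot all_order all_algebra finmap complex.
From mathcomp Require Import all_classical all_reals all_analysis.
From mathcomp Require Import showcase.summability.

Set Implicit Arguments.
Unset Strict Implicit.
Unset Printing Implicit Defensive.

Import Order.TTheory GRing.Theory Num.Theory.
Import numFieldNormedType.Exports.

Local Open Scope classical_set_scope.
Local Open Scope ring_scope.

(* The regular algebra [R[i]^o] carries the canonical structure of normed
   space over the field [R[i]], so that [differentiable] between the types
   below is complex (i.e. C-linear) Frechet differentiability. *)
Notation Cx R := ((R[i]%C)^o).
Notation Cx2 R := (Cx R * Cx R)%type.

Definition bidisc (R : realType) : set (Cx2 R) :=
  [set z | `|z.1| < 1 /\ `|z.2| < 1].

Definition holomorphic_on (R : realType) (U : set (Cx2 R))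
    (f : Cx2 R -> Cx R) : Prop :=
  forall z, U z -> differentiable f z.

Definition monomial (R : realType) (kl : nat * nat) : Cx2 R -> Cx R :=
  fun z => z.1 ^+ kl.1 * z.2 ^+ kl.2.

(* [f z = \sum_(k, l) a (k, l) z1^k z2^l] for all [z] in the bidisc; the double
   series converges unconditionally, along the net of finite partial sums. *)
Definition has_expansion (R : realType) (f : Cx2 R -> Cx R)
    (a : nat * nat -> Cx R) : Prop :=
  forall z, bidisc z ->
    partial_sum (fun kl => a kl * monomial kl z) @ totally --> f z.

(* The coefficients are unique when they exist; the default is irrelevant since
   [dirichlet] below only contains functions that have an expansion. *)
Definition coefs (R : realType) (f : Cx2 R -> Cx R) : nat * nat -> Cx R :=
  xget (fun=> 0) [set a | has_expansion f a].

(* [ComplexField.Normc.normc] is the modulus as an element of [R]. *)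
Definition dirichlet_norm2 (R : realType) (alpha : R) (f : Cx2 R -> Cx R) :
    \bar R :=
  \esum_(kl in [set: nat * nat])
    ((kl.1 + kl.2 + 1)%:R `^ alpha
      * ComplexField.Normc.normc (coefs f kl) ^+ 2)%:E.

Definition dirichlet_norm (R : realType) (alpha : R) (f : Cx2 R -> Cx R) :
    \bar R :=
  (dirichlet_norm2 alpha f `^ 2^-1)%E.

(* The elements are total functions whose values outside the bidisc are
   irrelevant: every notion here depends on the restriction to the bidisc. *)
Definition dirichlet (R : realType) (alpha : R) : set (Cx2 R -> Cx R) :=
  [set f | [/\ holomorphic_on (@bidisc R) f,
               exists a, has_expansion f a
             & (dirichlet_norm2 alpha f < +oo)%E]].

Definition linear_span (R : realType) (A : set (Cx2 R -> Cx R)) :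
    set (Cx2 R -> Cx R) :=
  [set h | exists (n : nat) (c : 'I_n -> Cx R) (g : 'I_n -> Cx2 R -> Cx R),
      (forall i, A (g i)) /\ h = (fun z => \sum_(i < n) c i * g i z)].

Definition dirichlet_closure (R : realType) (alpha : R)
    (A : set (Cx2 R -> Cx R)) : set (Cx2 R -> Cx R) :=
  [set g | dirichlet alpha g /\
     forall eps : R, 0 < eps -> exists h, [/\ A h, dirichlet alpha h &
       (dirichlet_norm alpha (fun z => h z - g z)%R < eps%:E)%E]].

Definition is_cyclic (R : realType) (alpha : R) (f : Cx2 R -> Cx R) : Prop :=
  dirichlet alpha f /\
  dirichlet_closure alpha
    (linear_span [set g | exists kl, g = (fun z => monomial kl z * f z)])
  = dirichlet alpha.

(* Main.v *)
Require Import Defs.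
From mathcomp Require Import all_boot all_order all_algebra finmap complex.
From mathcomp Require Import all_classical all_reals all_analysis.
From mathcomp Require Import showcase.summability.
From mathcomp Require Import ring lra zify.

(** Write p = 2 - z1 - z2 and w = (z1 + z2) / 2, so that p = 2 (1 - w).  Since
(k + l + 1)^alpha <= (k + l + 1)^2, the critical exponent 2 is the only one that
matters, and since polynomials are dense, it is enough to show that the closure
I of the polynomial multiples of p for the weight (k + l + 1)^2 contains every
monomial.  The weight depends on the degree only, so homogeneous polynomials of
different degrees are orthogonal, and one of degree n contributes (n + 1)^2
times its unweighted l2 norm squared.

Two averaging arguments give this.  Suppose that f_m is homogeneous of degree
m + 1 and f_m - x lies in I for all m.  Then x is congruent modulo I to the
average of f_0, ..., f_(M-1) with weights 1 / (m + 2), normalised by their sum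
H_M, and the squared norm of that average is H_M^-2 times the sum of the l2
norms squared of the f_m.  As the harmonic series diverges, x lies in I as soon
as that sum is O(H_M) ([harmonic_averaging]).

- With f_m = w^m (z1 - z2) / 2 and x = f_0: the differences f_(m+1) - f_m are
  multiples of 1 - w, and the parallelogram law gives
  |w^(m+1)|^2 + |f_m|^2 = |w^m|^2 in l2, so the sum telescopes and is at most 1.
  Hence z1 - z2 lies in I ([approximable_difop]), so z1 - 1 and z2 - 1 do, and
  all monomials are congruent to 1 modulo I.
- With f_m the mean of the m + 2 monomials of degree m + 1 and x = 1: the l2 norm
  squared of f_m is 1 / (m + 2), and the sum is exactly H_M.  Hence 1 lies in I
  ([approximable_delta0]).

This happens on arrays of coefficients.  To return to functions one needs that
the coefficients of an expansion are determined by its sum ([coefsE]). *)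
Set Implicit Arguments.
Unset Strict Implicit.
Unset Printing Implicit Defensive.

Import Order.TTheory GRing.Theory Num.Theory.
Import numFieldNormedType.Exports.

Local Open Scope classical_set_scope.
Local Open Scope ring_scope.

(** * Weighted square norms of coefficient arrays *)
Section Arrays.
Variable R : realType.
Implicit Types (a b x : nat * nat -> Cx R) (w : nat -> R) (c : Cx R).

(** The squared modulus is used instead of the modulus because it is polynomial
in the real and imaginary parts. *)
Definition nsq c : R := ComplexField.Normc.normc c ^+ 2.

Lemma nsqE (u v : R) : nsq (u +i* v)%C = u ^+ 2 + v ^+ 2.
Proof. by rewrite /nsq /= sqr_sqrtr// addr_ge0 ?sqr_ge0. Qed.

Lemma nsq_ge0 c : 0 <= nsq c. Proof. exact: sqr_ge0. Qed.

Lemma nsq0 : nsq 0 = 0.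
Proof. by rewrite nsqE; ring. Qed.

Lemma nsqM c c' : nsq (c * c') = nsq c * nsq c'.
Proof. by rewrite /nsq ComplexField.Normc.normcM exprMn. Qed.

Lemma nsqN c : nsq (- c) = nsq c.
Proof. by case: c => u v; rewrite !nsqE; ring. Qed.

Lemma nsq_real (u : R) : nsq (u%:C)%C = u ^+ 2.
Proof. by rewrite nsqE; ring. Qed.

Lemma nsqD c c' : nsq (c + c') <= 2 * nsq c + 2 * nsq c'.
Proof.
case: c => u v; case: c' => u' v'; rewrite !nsqE.
have := sqr_ge0 (u - u'); have := sqr_ge0 (v - v'); nra.
Qed.

Lemma nsq_parallelogram c c' :
  nsq (2^-1 * (c + c')) + nsq (2^-1 * (c - c')) = 2^-1 * (nsq c + nsq c').
Proof.
have -> : 2^-1 = ((2^-1 : R)%:C)%C :> Cx R by rewrite fmorphV rmorph_nat.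
rewrite !nsqM nsq_real; case: c => u v; case: c' => u' v'; rewrite !nsqE; by field.
Qed.

Definition wnorm2 w a : \bar R :=
  \esum_(kl in [set: nat * nat]) (w (kl.1 + kl.2)%N * nsq (a kl))%:E.

Arguments wnorm2 (w a)%_R.

Lemma wnorm2_ge0 w a : (forall n, 0 <= w n) -> (0 <= wnorm2 w a)%E.
Proof.
by move=> w0; apply: esum_ge0 => kl _; rewrite lee_fin mulr_ge0 ?nsq_ge0.
Qed.

Lemma le_wnorm2 w w' a : (forall n, w n <= w' n) ->
  (wnorm2 w a <= wnorm2 w' a)%E.
Proof.
by move=> ww'; apply: le_esum => kl _; rewrite lee_fin ler_wpM2r ?nsq_ge0.
Qed.

Lemma esumZ_le (r : R) (F : nat * nat -> R) : 0 <= r -> (forall i, 0 <= F i) ->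
  (\esum_(i in [set: nat * nat]) (r * F i)%:E
    <= r%:E * \esum_(i in [set: nat * nat]) (F i)%:E)%E.
Proof.
move=> r0 F0; apply: ge_ereal_sup => _ [X [finX _] <-].
under eq_fsbigr do rewrite EFinM.
rewrite -ge0_mule_fsumr; last by move=> i; rewrite lee_fin.
apply: lee_wpmul2l; first by rewrite lee_fin.
by apply: ereal_sup_ubound; exists X.
Qed.

Lemma wnorm2Z_le w c a : (forall n, 0 <= w n) ->
  (wnorm2 w (c *: a) <= (nsq c)%:E * wnorm2 w a)%E.
Proof.
move=> w0; apply: le_trans (esumZ_le (nsq_ge0 c) _); last first.
  by move=> kl; rewrite mulr_ge0 ?nsq_ge0.
by apply: le_esum => kl _; rewrite lee_fin nsqM mulrCA.
Qed.

Lemma wnorm2N w a : wnorm2 w (- a) = wnorm2 w a.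
Proof. by apply: eq_esum => kl _; rewrite opprfctE nsqN. Qed.

(** A substitute for the triangle inequality that needs no square roots; the
factors 2 are absorbed into the choice of epsilon. *)
Lemma wnorm2D_le w a b : (forall n, 0 <= w n) ->
  (wnorm2 w (a + b) <= 2%:E * wnorm2 w a + 2%:E * wnorm2 w b)%E.
Proof.
move=> w0; have t0 x kl : 0 <= w (kl.1 + kl.2)%N * nsq (x kl).
  by rewrite mulr_ge0 ?nsq_ge0.
apply: le_trans (leeD (esumZ_le (ler0n R 2) (t0 a)) (esumZ_le (ler0n R 2) (t0 b))).
rewrite -esumD; do 2?by move=> kl _; rewrite lee_fin mulr_ge0.
apply: le_esum => kl _; rewrite -EFinD lee_fin addrfctE.
have := nsqD (a kl) (b kl); have := w0 (kl.1 + kl.2)%N.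
move: (w _) (nsq (_ + _)) => W N; nra.
Qed.

Definition delta (kl : nat * nat) : nat * nat -> Cx R := fun ij => (ij == kl)%:R.

(** [shift1] and [shift2] are the multiplications by z1 and z2, on
coefficients. *)
Definition shift1 a : nat * nat -> Cx R :=
  fun kl => if kl.1 is k.+1 then a (k, kl.2) else 0.

Definition shift2 a : nat * nat -> Cx R :=
  fun kl => if kl.2 is l.+1 then a (kl.1, l) else 0.

Lemma shift1D a b : shift1 (a + b) = shift1 a + shift1 b.
Proof. by apply/funext => -[[|k] l]; rewrite !addrfctE /shift1/= ?addr0. Qed.

Lemma shift2D a b : shift2 (a + b) = shift2 a + shift2 b.
Proof. by apply/funext => -[k [|l]]; rewrite !addrfctE /shift2/= ?addr0. Qed.

Lemma shift1Z c a : shift1 (c *: a) = c *: shift1 a.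
Proof. by apply/funext => -[[|k] l]; rewrite !scalrfctE /shift1/= ?scaler0. Qed.

Lemma shift2Z c a : shift2 (c *: a) = c *: shift2 a.
Proof. by apply/funext => -[k [|l]]; rewrite !scalrfctE /shift2/= ?scaler0. Qed.

Lemma shift1_delta k l : shift1 (delta (k, l)) = delta (k.+1, l).
Proof. by apply/funext => -[[|i] j]. Qed.

Lemma shift2_delta k l : shift2 (delta (k, l)) = delta (k, l.+1).
Proof.
apply/funext => -[i [|j]]; rewrite /shift2 /delta ?xpair_eqE/= ?andbF//.
Qed.

Lemma wnorm2_shift1 w a : (forall n, 0 <= w n) ->
  wnorm2 w (shift1 a) = wnorm2 (fun n => w n.+1) a.
Proof.
move=> w0; rewrite /wnorm2.
rewrite (esumID (range (fun kl => (kl.1.+1, kl.2)))); last first.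
  by move=> kl _; rewrite lee_fin mulr_ge0 ?nsq_ge0.
rewrite !setTI [X in (_ + X)%E]esum1 ?adde0; last first.
  move=> [[|k] l] /=; first by rewrite nsq0 mulr0.
  by move=> []; exists (k, l).
rewrite esum_image; last by move=> [k l] [k' l'] _ _ /= [-> ->].
by apply: eq_esum => -[k l] _; rewrite /shift1/= addSn.
Qed.

Lemma wnorm2_shift2 w a : (forall n, 0 <= w n) ->
  wnorm2 w (shift2 a) = wnorm2 (fun n => w n.+1) a.
Proof.
move=> w0; rewrite /wnorm2.
rewrite (esumID (range (fun kl => (kl.1, kl.2.+1)))); last first.
  by move=> kl _; rewrite lee_fin mulr_ge0 ?nsq_ge0.
rewrite !setTI [X in (_ + X)%E]esum1 ?adde0; last first.
  move=> [k [|l]] /=; first by rewrite nsq0 mulr0.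
  by move=> []; exists (k, l).
rewrite esum_image; last by move=> [k l] [k' l'] _ _ /= [-> ->].
by apply: eq_esum => -[k l] _; rewrite /shift2/= addnS.
Qed.

Lemma wnorm2_delta w kl : (forall n, 0 <= w n) ->
  wnorm2 w (delta kl) = (w (kl.1 + kl.2)%N)%:E.
Proof.
move=> w0; rewrite /wnorm2 (esumID [set kl]); last first.
  by move=> ij _; rewrite lee_fin mulr_ge0 ?nsq_ge0.
rewrite !setTI esum_set1; last by rewrite lee_fin mulr_ge0 ?nsq_ge0.
rewrite [X in (_ + X)%E]esum1 ?adde0.
  by rewrite /delta eqxx nsqE/= expr1n expr0n addr0 mulr1.
by move=> ij /= /eqP/negPf ne; rewrite /delta ne nsq0 mulr0.
Qed.

Definition homogeneous n a := forall kl, (kl.1 + kl.2)%N != n -> a kl = 0.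

Lemma wnorm2_homogeneous_le w n a : (forall n, 0 <= w n) -> homogeneous n a ->
  (wnorm2 w a <= (w n)%:E * wnorm2 (fun=> 1%R) a)%E.
Proof.
move=> w0 an; apply: le_trans (esumZ_le (w0 n) _); last first.
  by move=> kl; rewrite mul1r nsq_ge0.
apply: le_esum => kl _; rewrite lee_fin mul1r.
have [<-//|/an ->] := eqVneq (kl.1 + kl.2)%N n.
by rewrite nsq0 !mulr0.
Qed.

(** At each index at most one of the arrays is nonzero, so the square of the sum
is the sum of the squares. *)
Lemma wnorm2_disjoint w (I : choiceType) (s : seq I) (f : I -> nat * nat -> Cx R) :
  (forall n, 0 <= w n) -> uniq s ->
  (forall i j kl, i != j -> f i kl = 0 \/ f j kl = 0) ->
  wnorm2 w (\sum_(i <- s) f i)%R = (\sum_(i <- s) wnorm2 w (f i))%E.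
Proof.
move=> w0 us disj; rewrite /wnorm2 -esum_sum; last first.
  by move=> kl i _ _; rewrite lee_fin mulr_ge0 ?nsq_ge0.
apply: eq_esum => kl _; rewrite sumEFin fct_sumE -mulr_sumr; congr (_ * _)%:E.
have [/hasP[i si /eqP/eqP fi0]|/hasPn f0] := boolP (has (fun i => f i kl != 0) s).
  rewrite !(big_rem _ si) /=.
  have f0 j : j \in rem i s -> f j kl = 0.
    rewrite mem_rem_uniq// !inE => /andP[ji _].
    by case: (disj _ _ kl ji) => // fi; rewrite fi eqxx in fi0.
  rewrite !big_seq big1 ?addr0; last by move=> j /f0.
  by rewrite big1 ?addr0// => j /f0 ->; rewrite nsq0.
rewrite !big_seq big1 ?nsq0.
  by rewrite big1// => j /f0/negbNE/eqP ->; rewrite nsq0.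
by move=> j /f0/negbNE/eqP.
Qed.

End Arrays.

(** * The closure of the polynomial multiples of p *)
Section Approximation.
Variable R : realType.
Implicit Types (a b q : nat * nat -> Cx R) (c : Cx R).

(** Coefficients of a polynomial. *)
Definition finite_array q := exists s : seq (Cx R * (nat * nat)),
  q = \sum_(x <- s) x.1 *: delta R x.2.

Lemma finite_array_delta kl : finite_array (delta R kl).
Proof. by exists [:: (1, kl)]; rewrite big_seq1 scale1r. Qed.

Lemma finite_arrayD q q' :
  finite_array q -> finite_array q' -> finite_array (q + q').
Proof. by move=> [s ->] [s' ->]; exists (s ++ s'); rewrite big_cat. Qed.

Lemma finite_arrayZ c q : finite_array q -> finite_array (c *: q).
Proof.
move=> [s ->]; exists [seq (c * x.1, x.2) | x <- s].
by rewrite big_map scaler_sumr; apply: eq_bigr => x _; rewrite scalerA.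
Qed.

Lemma finite_arrayN q : finite_array q -> finite_array (- q).
Proof. by rewrite -scaleN1r; exact: finite_arrayZ. Qed.

Lemma shift1N a : shift1 (- a) = - shift1 a.
Proof. by rewrite -scaleN1r shift1Z scaleN1r. Qed.

Lemma shift2N a : shift2 (- a) = - shift2 a.
Proof. by rewrite -scaleN1r shift2Z scaleN1r. Qed.

Lemma shift1_sum (I : Type) (s : seq I) (f : I -> nat * nat -> Cx R) :
  shift1 (\sum_(i <- s) f i) = \sum_(i <- s) shift1 (f i).
Proof.
apply: (big_morph (@shift1 R)); first exact: shift1D.
by rewrite -(scale0r (delta R (0, 0)%N)) shift1Z !scale0r.
Qed.

Lemma shift2_sum (I : Type) (s : seq I) (f : I -> nat * nat -> Cx R) :
  shift2 (\sum_(i <- s) f i) = \sum_(i <- s) shift2 (f i).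
Proof.
apply: (big_morph (@shift2 R)); first exact: shift2D.
by rewrite -(scale0r (delta R (0, 0)%N)) shift2Z !scale0r.
Qed.

Lemma finite_array_shift1 q : finite_array q -> finite_array (shift1 q).
Proof.
move=> [s ->]; exists [seq (x.1, (x.2.1.+1, x.2.2)) | x <- s].
rewrite big_map shift1_sum; apply: eq_bigr => -[c [k l]] _ /=.
by rewrite shift1Z shift1_delta.
Qed.

Lemma finite_array_shift2 q : finite_array q -> finite_array (shift2 q).
Proof.
move=> [s ->]; exists [seq (x.1, (x.2.1, x.2.2.+1)) | x <- s].
rewrite big_map shift2_sum; apply: eq_bigr => -[c [k l]] _ /=.
by rewrite shift2Z shift2_delta.
Qed.

Lemma shift12 a : shift1 (shift2 a) = shift2 (shift1 a).
Proof. by apply/funext => -[[|k] [|l]]. Qed.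

(** Multiplication by 2 - z1 - z2, on coefficients. *)
Definition mulp q := 2 *: q - shift1 q - shift2 q.

Lemma mulpD q q' : mulp (q + q') = mulp q + mulp q'.
Proof.
rewrite /mulp shift1D shift2D; apply/funext => kl; rewrite !fctE.
rewrite /GRing.scale/=; ring.
Qed.

Lemma mulpZ c q : mulp (c *: q) = c *: mulp q.
Proof.
rewrite /mulp shift1Z shift2Z; apply/funext => kl; rewrite !fctE.
rewrite /GRing.scale/=; ring.
Qed.

Lemma mulp_shift1 q : mulp (shift1 q) = shift1 (mulp q).
Proof. by rewrite /mulp !shift1D !shift1N !shift1Z shift12. Qed.

Lemma mulp_shift2 q : mulp (shift2 q) = shift2 (mulp q).
Proof. by rewrite /mulp !shift2D !shift2N !shift2Z shift12. Qed.

Definition quad_weight (n : nat) : R := n.+1%:R ^+ 2.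

Lemma quad_weight_ge0 n : 0 <= quad_weight n. Proof. exact: sqr_ge0. Qed.

Lemma quad_weightS n : quad_weight n.+1 <= 4 * quad_weight n.
Proof.
rewrite /quad_weight -addn1 natrD; have : 1 <= n.+1%:R :> R by rewrite ler1n.
nra.
Qed.

Local Notation qnorm2 := (wnorm2 quad_weight).

(** Membership in the closure of the polynomial multiples of p, for the critical
weight. *)
Definition approximable a := forall eps : R, 0 < eps ->
  exists q, finite_array q /\ (qnorm2 (mulp q - a)%R <= eps%:E)%E.

Lemma approximableD a b :
  approximable a -> approximable b -> approximable (a + b).
Proof.
move=> Ia Ib e e0; have e4 : 0 < e / 4 by rewrite divr_gt0.
have [q [fq qa]] := Ia _ e4; have [q' [fq' qb]] := Ib _ e4.
exists (q + q'); split; first exact: finite_arrayD.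
rewrite mulpD opprD addrACA.
apply: le_trans (wnorm2D_le _ _ quad_weight_ge0) _.
have -> : e%:E = (2%:E * (e / 4)%:E + 2%:E * (e / 4)%:E)%E.
  by rewrite -!EFinM -EFinD; congr _%:E; field.
by apply: leeD; apply: lee_wpmul2l.
Qed.

(** A bounded operator that commutes with the multiplication by p preserves the
closure of the multiples of p. *)
Lemma approximable_lift (F : (nat * nat -> Cx R) -> nat * nat -> Cx R)
    (K : R) : 0 < K ->
  (forall a b, F (a - b) = F a - F b) ->
  (forall q, finite_array q -> finite_array (F q)) ->
  (forall q, mulp (F q) = F (mulp q)) ->
  (forall a, (qnorm2 (F a) <= K%:E * qnorm2 a)%E) ->
  forall a, approximable a -> approximable (F a).
Proof.
move=> K0 FB Ffin Fmul Fle a Ia e e0.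
have [q [fq qa]] := Ia _ (divr_gt0 e0 K0).
exists (F q); split; first exact: Ffin.
rewrite Fmul -FB; apply: le_trans (Fle _) _.
have -> : e%:E = (K%:E * (e / K)%:E)%E.
  by rewrite -!EFinM; congr _%:E; rewrite mulrC divfK ?gt_eqF.
by apply: lee_wpmul2l => //; rewrite lee_fin ltW.
Qed.

Lemma qnorm2_shift w a : (forall n, w n = quad_weight n.+1) ->
  (wnorm2 w a <= 4%:E * qnorm2 a)%E.
Proof.
move=> wE; apply: le_trans (esumZ_le (ler0n R 4) _); last first.
  by move=> kl; rewrite mulr_ge0 ?nsq_ge0 ?quad_weight_ge0.
apply: le_esum => kl _; rewrite lee_fin mulrA wE ler_wpM2r ?nsq_ge0//.
exact: quad_weightS.
Qed.

Lemma approximable_shift1 a : approximable a -> approximable (shift1 a).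
Proof.
apply: (@approximable_lift _ 4) => //.
- by move=> b b'; rewrite shift1D shift1N.
- exact: finite_array_shift1.
- exact: mulp_shift1.
- move=> b; rewrite wnorm2_shift1; last exact: quad_weight_ge0.
  exact: qnorm2_shift.
Qed.

Lemma approximable_shift2 a : approximable a -> approximable (shift2 a).
Proof.
apply: (@approximable_lift _ 4) => //.
- by move=> b b'; rewrite shift2D shift2N.
- exact: finite_array_shift2.
- exact: mulp_shift2.
- move=> b; rewrite wnorm2_shift2; last exact: quad_weight_ge0.
  exact: qnorm2_shift.
Qed.

Lemma approximableZ c a : approximable a -> approximable (c *: a).
Proof.
apply: (@approximable_lift _ (nsq c + 1)) => //.
- by rewrite ltr_wpDl ?nsq_ge0.
- by move=> b b'; rewrite scalerBr.
- by move=> q; exact: finite_arrayZ.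
- by move=> q; rewrite mulpZ.
- move=> b; apply: le_trans (wnorm2Z_le _ _ quad_weight_ge0) _.
  apply: lee_wpmul2r; first exact: wnorm2_ge0 quad_weight_ge0.
  by rewrite lee_fin lerDl.
Qed.

Lemma approximableN a : approximable a -> approximable (- a).
Proof. by rewrite -scaleN1r; exact: approximableZ. Qed.

Lemma approximableB a b :
  approximable a -> approximable b -> approximable (a - b).
Proof. by move=> Ia Ib; apply/approximableD/approximableN. Qed.

Lemma approximable_mulp q : finite_array q -> approximable (mulp q).
Proof.
move=> fq e e0; exists q; split => //.
rewrite subrr /wnorm2 esum1 ?lee_fin ?ltW// => kl _.
by rewrite nsq0 mulr0.
Qed.

Lemma approximable0 : approximable 0.
Proof.
rewrite -(scale0r (mulp (delta R (0, 0)%N))).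
exact/approximableZ/approximable_mulp/finite_array_delta.
Qed.

Lemma approximable_sum (I : Type) (s : seq I) (f : I -> nat * nat -> Cx R) :
  (forall i, approximable (f i)) -> approximable (\sum_(i <- s) f i).
Proof.
move=> If; elim/big_ind: _ => //; first exact: approximable0.
exact: approximableD.
Qed.

Lemma approximable_closed a :
  (forall eps : R, 0 < eps ->
    exists b, approximable b /\ (qnorm2 (b - a)%R <= eps%:E)%E) ->
  approximable a.
Proof.
move=> Ha e e0; have e4 : 0 < e / 4 by rewrite divr_gt0.
have [b [Ib ba]] := Ha _ e4; have [q [fq qb]] := Ib _ e4.
exists q; split => //; rewrite -(subrKA b).
apply: le_trans (wnorm2D_le _ _ quad_weight_ge0) _.
have -> : e%:E = (2%:E * (e / 4)%:E + 2%:E * (e / 4)%:E)%E.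
  by rewrite -!EFinM -EFinD; congr _%:E; field.
by apply: leeD; apply: lee_wpmul2l.
Qed.

(** The sum starts at 1 / 2 because the averaged polynomials have degree m + 1,
hence weight (m + 2)^2. *)
Definition hsum (M : nat) : R := \sum_(0 <= m < M) m.+2%:R^-1.

Lemma hsum_unbounded (B : R) : exists M, B < hsum M.
Proof.
apply: contrapT => /forallNP H.
apply: (@dvg_harmonic R); apply: nondecreasing_is_cvgn.
  by apply: nondecreasing_series => n _ _; exact: harmonic_ge0.
exists (1 + B) => _ [[|n] _ <-].
  rewrite /series/= big_geq// addr_ge0//.
  by have /negP := H 0%N; rewrite /hsum big_geq// -leNgt.
rewrite /series/= big_nat_recl// invr1 lerD2l leNgt.
exact/negP/(H n).
Qed.

End Approximation.

(** * Harmonic averaging *)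
Section Averaging.
Variable R : realType.
Implicit Types (a b x q : nat * nat -> Cx R) (c : Cx R).

Local Notation l2norm2 := (wnorm2 (fun=> 1%R : R)).
Local Notation qnorm2 := (wnorm2 (@quad_weight R)).

Lemma homogeneousZ n c a : homogeneous n a -> homogeneous n (c *: a).
Proof. by move=> an kl /an akl; rewrite scalrfctE akl scaler0. Qed.

Lemma homogeneous_disjoint (f : nat -> nat * nat -> Cx R) :
  (forall m, homogeneous m.+1 (f m)) ->
  forall i j kl, i != j -> f i kl = 0 \/ f j kl = 0.
Proof.
move=> fh i j kl ij; have [E|/fh ->] := eqVneq (kl.1 + kl.2)%N i.+1; last by left.
by right; apply: fh; rewrite E eqSS.
Qed.

(** The coefficients c_m = 1 / (H_M (m + 2)) cancel the weights (m + 2)^2 of the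
f_m: the average has squared norm at most K H_M / H_M^2 = K / H_M, and H_M is
unbounded. *)
Lemma harmonic_averaging (K : R) (f : nat -> nat * nat -> Cx R) x :
  0 < K ->
  (forall m, homogeneous m.+1 (f m)) ->
  (forall m, approximable (f m - x)) ->
  (forall M, (\sum_(0 <= m < M) l2norm2 (f m) <= (K * hsum R M)%:E)%E) ->
  approximable x.
Proof.
move=> K0 fh fx fK; apply: approximable_closed => e e0.
have [M KM] := hsum_unbounded (K / e).
have L0 : 0 < hsum R M by apply: lt_trans KM; rewrite divr_gt0.
pose r m : R := (hsum R M)^-1 * m.+2%:R^-1.
pose c m : Cx R := ((r m)%:C)%C.
have c1 : \sum_(0 <= m < M) c m = 1.
  rewrite -(rmorph_sum (real_complex R)) -mulr_sumr mulVf ?rmorph1//.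
  by rewrite gt_eqF.
(* As the c_m add up to 1, this array is x minus the average of the f_m. *)
exists (- \sum_(0 <= m < M) c m *: (f m - x)); split.
  by apply/approximableN/approximable_sum => m; exact: approximableZ.
have -> : - (\sum_(0 <= m < M) c m *: (f m - x)) - x
    = - \sum_(0 <= m < M) c m *: f m.
  under eq_bigr do rewrite scalerBr.
  by rewrite sumrB -scaler_suml c1 scale1r opprB addrAC subrr sub0r.
rewrite wnorm2N wnorm2_disjoint ?iota_uniq//; first last.
- by apply: homogeneous_disjoint => m; exact: homogeneousZ.
- exact: quad_weight_ge0.
apply: (@le_trans _ _
    (\sum_(0 <= m < M) ((hsum R M) ^- 2)%:E * l2norm2 (f m))%E).
  apply: lee_sum => m _.
  apply: le_trans (wnorm2Z_le _ _ (@quad_weight_ge0 R)) _.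
  apply: (@le_trans _ _
      ((nsq (c m))%:E * ((quad_weight R m.+1)%:E * l2norm2 (f m)))%E).
    apply: lee_wpmul2l; first by rewrite lee_fin nsq_ge0.
    apply: wnorm2_homogeneous_le => //; exact: quad_weight_ge0.
  rewrite muleA -EFinM; apply: lee_wpmul2r; first exact: wnorm2_ge0.
  rewrite lee_fin nsq_real /r /quad_weight exprMn !exprVn -mulrA mulVf ?mulr1//.
rewrite -ge0_sume_distrr; last by move=> m _; exact: wnorm2_ge0.
apply: le_trans (lee_wpmul2l _ (fK M)) _.
  by rewrite lee_fin invr_ge0 sqr_ge0.
rewrite -EFinM lee_fin mulrC ler_pdivrMr ?exprn_gt0//.
rewrite expr2 mulrA ler_wpM2r ?ltW//.
by rewrite mulrC -ltr_pdivrMr.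
Qed.

(** Multiplications by w = (z1 + z2) / 2 and by (z1 - z2) / 2. *)
Definition avgop a : nat * nat -> Cx R := 2^-1 *: (shift1 a + shift2 a).
Definition difop a : nat * nat -> Cx R := 2^-1 *: (shift1 a - shift2 a).

(** The shifts are isometries for the unweighted norm, so this is the
parallelogram law applied to [shift1 a] and [shift2 a]. *)
Lemma l2norm2_parallelogram a :
  (l2norm2 (avgop a) + l2norm2 (difop a) <= l2norm2 a)%E.
Proof.
have p0 : forall n : nat, 0 <= 1 :> R by [].
rewrite -esumD; do 2?by move=> kl _; rewrite lee_fin mul1r nsq_ge0.
apply: (@le_trans _ _ (\esum_(kl in [set: nat * nat])
    (2^-1 * (1 * nsq (shift1 a kl) + 1 * nsq (shift2 a kl)))%:E)%E).
  apply: le_esum => kl _.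
  by rewrite -EFinD lee_fin !mul1r -nsq_parallelogram.
apply: le_trans (esumZ_le _ _) _.
- by rewrite invr_ge0.
- by move=> kl; rewrite !mul1r addr_ge0 ?nsq_ge0.
under eq_esum do rewrite EFinD.
rewrite esumD; do 2?by move=> kl _; rewrite lee_fin mul1r nsq_ge0.
rewrite -/(l2norm2 (shift1 a)) -/(l2norm2 (shift2 a)).
rewrite wnorm2_shift1// wnorm2_shift2// -mule2n -mule_natl muleA -EFinM.
by rewrite mulVf ?mul1e ?pnatr_eq0.
Qed.

Lemma avgop_difop a : avgop (difop a) = difop (avgop a).
Proof.
rewrite /avgop /difop !(shift1Z, shift2Z, shift1D, shift2D, shift1N, shift2N).
rewrite shift12; apply/funext => kl; rewrite !fctE /GRing.scale/=; ring.
Qed.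

Lemma finite_array_avgop q : finite_array q -> finite_array (avgop q).
Proof.
move=> fq; apply/finite_arrayZ/finite_arrayD; first exact: finite_array_shift1.
exact: finite_array_shift2.
Qed.

Lemma finite_array_difop q : finite_array q -> finite_array (difop q).
Proof.
move=> fq; apply/finite_arrayZ/finite_arrayD; first exact: finite_array_shift1.
exact/finite_arrayN/finite_array_shift2.
Qed.

(** w q - q = p (- q / 2). *)
Lemma approximable_avgopB q : finite_array q -> approximable (avgop q - q).
Proof.
move=> fq; have -> : avgop q - q = mulp (- 2^-1 *: q).
  rewrite mulpZ /mulp /avgop; apply/funext => kl; rewrite !fctE /GRing.scale/=.
  by field.
exact/approximable_mulp/finite_arrayZ.
Qed.

Lemma homogeneous_shift1 n a : homogeneous n a -> homogeneous n.+1 (shift1 a).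
Proof. by move=> an [[|k] l]//= kln; apply: an; rewrite addSn eqSS in kln. Qed.

Lemma homogeneous_shift2 n a : homogeneous n a -> homogeneous n.+1 (shift2 a).
Proof. by move=> an [k [|l]]//= kln; apply: an; rewrite addnS eqSS in kln. Qed.

Lemma homogeneousD n a b :
  homogeneous n a -> homogeneous n b -> homogeneous n (a + b).
Proof. by move=> an bn kl kln; rewrite addrfctE an// bn// addr0. Qed.

Lemma homogeneous_avgop n a : homogeneous n a -> homogeneous n.+1 (avgop a).
Proof.
move=> an; apply/homogeneousZ/homogeneousD; first exact: homogeneous_shift1.
exact: homogeneous_shift2.
Qed.

Lemma homogeneous_difop n a : homogeneous n a -> homogeneous n.+1 (difop a).
Proof.
move=> an; apply/homogeneousZ/homogeneousD; first exact: homogeneous_shift1.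
by rewrite -scaleN1r; exact/homogeneousZ/homogeneous_shift2.
Qed.

Lemma homogeneous_delta k l : homogeneous (k + l)%N (delta R (k, l)).
Proof.
move=> ij; rewrite /delta; have [->|//] := eqVneq ij (k, l).
by rewrite eqxx.
Qed.

(** The polynomials f_m = w^m (z1 - z2) / 2 are congruent to f_0, and their
unweighted norms are summable because the parallelogram law makes them the
decrements of |w^m|^2. *)
Lemma approximable_difop : approximable (difop (delta R (0, 0)%N)).
Proof.
pose d0 := delta R (0, 0)%N.
pose g m := iter m avgop d0; pose f m := difop (g m).
have gfin m : finite_array (g m).
  elim: m => [|m IH]; first exact: finite_array_delta.
  exact: finite_array_avgop.
have fS m : f m.+1 = avgop (f m) by rewrite /f avgop_difop.
apply: (@harmonic_averaging 2 f) => //.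
- move=> m; apply: homogeneous_difop; rewrite /g.
  elim: m => [|m IH]; first exact: (@homogeneous_delta 0 0).
  exact: homogeneous_avgop.
- elim=> [|m IH]; first by rewrite subrr; exact: approximable0.
  rewrite -(subrKA (f m)); apply: approximableD => //; rewrite fS.
  exact/approximable_avgopB/finite_array_difop.
- move=> [|M]; first by rewrite /hsum !big_geq// mulr0.
  apply: (@le_trans _ _ 1%E).
    apply: (@le_trans _ _
        (\sum_(0 <= m < M.+1) l2norm2 (f m) + l2norm2 (g M.+1))%E).
      by apply: leeDl; exact: wnorm2_ge0.
    elim: M.+1 => [|m IH].
      by rewrite big_geq// add0e wnorm2_delta.
    rewrite big_nat_recr//= -addeA [X in (_ + X)%E]addeC.
    by apply: le_trans IH; apply: leeD => //; exact: l2norm2_parallelogram.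
  rewrite lee_fin /hsum big_nat_recl// mulrDr mulfV ?pnatr_eq0// lerDl.
  by rewrite mulr_ge0// sumr_ge0.
Qed.

(** Modulo the closure both w - 1 and (z1 - z2) / 2 vanish, hence so do z1 - 1 and
z2 - 1, and then all differences of monomials. *)
Lemma approximable_deltaB k l :
  approximable (delta R (k, l) - delta R (0, 0)%N).
Proof.
have Ha : approximable (avgop (delta R (0, 0)%N) - delta R (0, 0)%N).
  exact/approximable_avgopB/finite_array_delta.
have I10 : approximable (delta R (1, 0)%N - delta R (0, 0)%N).
  have -> : delta R (1, 0)%N - delta R (0, 0)%N
      = (avgop (delta R (0, 0)%N) - delta R (0, 0)%N) + difop (delta R (0, 0)%N).
    rewrite /avgop /difop !shift1_delta !shift2_delta; apply/funext => kl.
    by rewrite !fctE /GRing.scale/=; field.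
  by apply: approximableD => //; exact: approximable_difop.
have I01 : approximable (delta R (0, 1)%N - delta R (0, 0)%N).
  have -> : delta R (0, 1)%N - delta R (0, 0)%N
      = (avgop (delta R (0, 0)%N) - delta R (0, 0)%N) - difop (delta R (0, 0)%N).
    rewrite /avgop /difop !shift1_delta !shift2_delta; apply/funext => kl.
    by rewrite !fctE /GRing.scale/=; field.
  by apply: approximableB => //; exact: approximable_difop.
elim: k => [|k IH].
  elim: l => [|l IH]; first by rewrite subrr; exact: approximable0.
  rewrite -(subrKA (delta R (0, 1)%N)); apply: approximableD => //.
  by rewrite -!shift2_delta -shift2N -shift2D; exact: approximable_shift2.
rewrite -(subrKA (delta R (1, 0)%N)); apply: approximableD => //.
by rewrite -!shift1_delta -shift1N -shift1D; exact: approximable_shift1.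
Qed.

(** The mean of the monomials of degree m + 1 is congruent to 1, and its
unweighted square norm 1 / (m + 2) is the general term of [hsum]: this is where
the exponent 2 is critical. *)
Lemma approximable_delta0 : approximable (delta R (0, 0)%N).
Proof.
pose c m : Cx R := ((m.+2%:R^-1 : R)%:C)%C.
pose f m := \sum_(0 <= k < m.+2) c m *: delta R (k, (m.+1 - k)%N).
apply: (@harmonic_averaging 1 f) => //.
- move=> m kl klm; rewrite /f fct_sumE big_nat big1// => k km.
  apply/homogeneousZ; last exact: klm.
  by have := @homogeneous_delta k (m.+1 - k)%N; rewrite subnKC.
- move=> m.
  have -> : f m - delta R (0, 0)%N = \sum_(0 <= k < m.+2)
      c m *: (delta R (k, (m.+1 - k)%N) - delta R (0, 0)%N).
    under [RHS]eq_bigr do rewrite scalerBr.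
    rewrite sumrB; congr (_ - _).
    rewrite -scaler_suml sumr_const_nat subn0 -rmorphMn/= -[X in (X%:C)%C]mulr_natr mulVf//.
    by rewrite scale1r.
  by apply: approximable_sum => k; exact/approximableZ/approximable_deltaB.
- move=> M; rewrite mul1r /hsum -sumEFin; apply: lee_sum => m _.
  rewrite /f wnorm2_disjoint ?iota_uniq//; last first.
    move=> i j kl ij; rewrite !fctE /delta.
    have [->|] := eqVneq kl (i, (m.+1 - i)%N); last by left; rewrite scaler0.
    by right; rewrite xpair_eqE (negPf ij) scaler0.
  apply: (@le_trans _ _ (\sum_(0 <= k < m.+2) ((m.+2%:R^-1) ^+ 2)%:E)%E).
    apply: lee_sum => k _; apply: le_trans (wnorm2Z_le _ _ _) _ => //.
    by rewrite wnorm2_delta// mule1 nsq_real.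
  rewrite sumEFin lee_fin sumr_const_nat subn0 -[leLHS]mulr_natr expr2 -mulrA.
  by rewrite mulVf ?mulr1// pnatr_eq0.
Qed.

Lemma approximable_finite_array q : finite_array q -> approximable q.
Proof.
move=> [s ->]; apply: approximable_sum => -[c [k l]]; apply: approximableZ.
rewrite -(subrK (delta R (0, 0)%N) (delta R _)); apply: approximableD.
  exact: approximable_deltaB.
exact: approximable_delta0.
Qed.

End Averaging.

(** * Uniqueness of expansions *)
#[local] Existing Instance totally_filter.

Section Expansions.
Variable R : realType.
Implicit Types (a b d : nat * nat -> Cx R) (f g : Cx2 R -> Cx R) (c : Cx R).
Implicit Type z : Cx2 R.

Local Notation nc := (@ComplexField.Normc.normc R).

Lemma partial_sumE (x : nat * nat -> Cx R) (A : {fset nat * nat}) :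
  partial_sum x A = \sum_(i <- A) x i.
Proof. by rewrite /partial_sum [RHS]big_seq_fsetE. Qed.

Lemma has_expansionD f g a b :
  has_expansion f a -> has_expansion g b -> has_expansion (f + g) (a + b).
Proof.
move=> fa gb z Dz; rewrite addrfctE.
have -> : partial_sum (fun kl => (a + b) kl * monomial kl z) =
    partial_sum (fun kl => a kl * monomial kl z)
    + partial_sum (fun kl => b kl * monomial kl z).
  apply/funext => A; rewrite -[RHS]/(partial_sum _ A + partial_sum _ A) !partial_sumE -big_split/=.
  by apply: eq_bigr => i _; rewrite addrfctE mulrDl.
exact: (cvgD (fa z Dz) (gb z Dz)).
Qed.

Lemma has_expansionZ c f a : has_expansion f a -> has_expansion (c *: f) (c *: a).
Proof.
move=> fa z Dz.
have -> : partial_sum (fun kl => (c *: a) kl * monomial kl z) =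
    (fun A => c * partial_sum (fun kl => a kl * monomial kl z) A).
  apply/funext => A; rewrite !partial_sumE mulr_sumr.
  by apply: eq_bigr => i _; rewrite mulrA.
exact: (cvgM (cvg_cst c) (fa z Dz)).
Qed.

Lemma has_expansionB f g a b :
  has_expansion f a -> has_expansion g b -> has_expansion (f - g) (a - b).
Proof.
by move=> fa gb; rewrite -(scaleN1r g) -(scaleN1r b); exact/has_expansionD/has_expansionZ.
Qed.

Lemma has_expansion_monomial kl : has_expansion (monomial kl) (delta R kl).
Proof.
move=> z Dz; apply: cvg_near_cst; exists [fset kl]%fset => // A /= klA.
rewrite partial_sumE (big_fsetD1 kl)/=; last by rewrite -fsub1set.
rewrite /delta eqxx mul1r big_seq big1 ?addr0// => i.
by rewrite !inE => /andP[/negPf -> _]; rewrite mul0r.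
Qed.

Lemma normc_ge0 c : 0 <= nc c. Proof. by case: c => u v; exact: sqrtr_ge0. Qed.

Lemma normc_sum (I : Type) (s : seq I) (x : I -> Cx R) :
  nc (\sum_(i <- s) x i) <= \sum_(i <- s) nc (x i).
Proof.
elim/big_ind2: _ => //; first by rewrite ComplexField.Normc.normc0.
by move=> u u' v v' uu' vv'; apply: le_trans (le_normcD _ _) _; exact: lerD.
Qed.

Lemma normcX c n : nc (c ^+ n) = nc c ^+ n.
Proof.
elim: n => [|n IH]; first by rewrite !expr0 ComplexField.Normc.normc1.
by rewrite !exprS ComplexField.Normc.normcM IH.
Qed.

Lemma normc_real (r : R) : 0 <= r -> nc (r%:C)%C = r.
Proof. by move=> r0; rewrite /= expr0n/= addr0 sqrtr_sqr ger0_norm. Qed.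

(** A real-valued form of the convergence, since the norm of [R[i]] takes its
values in the partially ordered field [R[i]]. *)
Lemma cvg0_normc (x : nat * nat -> Cx R) : partial_sum x @ totally --> (0 : Cx R) ->
  forall e : R, 0 < e -> exists A : {fset nat * nat},
    forall B : {fset nat * nat}, (A `<=` B)%fset -> nc (\sum_(i <- B) x i) < e.
Proof.
move=> /cvgr0Pnorm_lt x0 e e0.
have /x0 [A _ HA] : 0 < (e%:C)%C :> R[i] by rewrite ltcR.
exists A => B /HA /=.
by rewrite partial_sumE /Num.norm/= ltcR.
Qed.

(** The finite set lies in a square box, over which the sum is the square of a
geometric sum. *)
Lemma sum_quarter_pow_le (s : seq (nat * nat)) : uniq s ->
  \sum_(kl <- s) (4^-1 : R) ^+ (kl.1 + kl.2) <= 4.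
Proof.
move=> us; pose M := (\max_(kl <- s) (kl.1 + kl.2)).+1.
pose G := \sum_(0 <= i < M) (4^-1 : R) ^+ i.
have GE : G = (4 - 4 * 4^-1 ^+ M) / 3.
  rewrite /G; elim: (M) => [|m IH]; first by rewrite big_geq// expr0; field.
  by rewrite big_nat_recr//= IH exprS; field.
have p0 : 0 <= (4^-1 : R) ^+ M by rewrite exprn_ge0.
have G0 : 0 <= G by apply: sumr_ge0 => i _; rewrite exprn_ge0.
have G2 : G <= 2 by rewrite GE; lra.
apply: (@le_trans _ _ (G * G)); last by nra.
pose box := [seq (i, j) | i <- index_iota 0 M, j <- index_iota 0 M].
have -> : G * G = \sum_(kl <- box) (4^-1 : R) ^+ (kl.1 + kl.2).
  rewrite big_allpairs mulr_suml; apply: eq_bigr => i _.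
  by rewrite mulr_sumr; apply: eq_bigr => j _; rewrite exprD.
rewrite [leRHS](bigID (mem s))/= -[X in _ <= X + _]big_filter.
have ps : perm_eq s [seq kl <- box | kl \in s].
  apply: uniq_perm => //.
    apply: filter_uniq; apply: allpairs_uniq; rewrite ?iota_uniq//.
    by move=> [? ?] [? ?].
  move=> [k l]; rewrite mem_filter; have [kls|//] := boolP ((k, l) \in s).
  apply/esym/allpairsP; exists (k, l) => /=.
  have klM : (k + l < M)%N by rewrite ltnS; exact: (leq_bigmax_seq _ kls).
  by rewrite !mem_index_iota; split => //; lia.
by rewrite -(perm_big _ ps)/= lerDl sumr_ge0// => i _; rewrite exprn_ge0.
Qed.

Lemma normc_monomial kl z : nc (monomial kl z) = nc z.1 ^+ kl.1 * nc z.2 ^+ kl.2.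
Proof. by rewrite /monomial ComplexField.Normc.normcM !normcX. Qed.

Lemma bidisc_real (s t : R) : 0 <= s -> s < 1 -> 0 <= t -> t < 1 ->
  bidisc ((s%:C)%C : Cx R, (t%:C)%C : Cx R).
Proof.
move=> s0 s1 t0 t1.
by split; rewrite /Num.norm/= expr0n/= addr0 sqrtr_sqr ger0_norm// ltcR.
Qed.

(** At z1 = z2 = 1 / 2 all but finitely many terms have modulus at most 2, by the
Cauchy criterion along the net of finite sums. *)
Lemma expansion0_bound d : has_expansion (0 : Cx2 R -> Cx R) d ->
  exists2 C : R, 0 <= C & forall kl, nc (d kl) <= C * 2 ^+ (kl.1 + kl.2).
Proof.
move=> d0; pose h : Cx R := ((2^-1 : R)%:C)%C.
have nh : nc h = 2^-1 by rewrite normc_real.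
pose x kl := d kl * monomial kl (h, h).
have nx kl : nc (x kl) = nc (d kl) * 2^-1 ^+ (kl.1 + kl.2).
  by rewrite /x ComplexField.Normc.normcM normc_monomial nh -exprD.
have [|A HA] := @cvg0_normc x _ 1 ltr01.
  by apply: d0; apply: bidisc_real; lra.
have S0 : 0 <= \sum_(i <- A) nc (x i) by apply: sumr_ge0 => i _; exact: normc_ge0.
exists (2 + \sum_(i <- A) nc (x i)); first by rewrite addr_ge0.
move=> kl; rewrite -ler_pdivrMr ?exprn_gt0// -exprVn -nx.
have [klA|klA] := boolP (kl \in A).
  rewrite [leRHS]addrC (big_fsetD1 kl)//= -addrA lerDl addr_ge0//.
  by apply: sumr_ge0 => i _; exact: normc_ge0.
have := HA (kl |` A)%fset (fsubsetUr _ _); rewrite big_fsetU1//= => H1.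
have H2 := HA A (fsubset_refl _).
rewrite -[x kl](addrK (\sum_(i <- A) x i)).
apply: le_trans (le_normcD _ _) _.
by rewrite normcN; lra.
Qed.

(** The curve z1 = t^(N+1) / 8, z2 = t^N / 8 with N = k0 + l0 + 1 gives the term of
index (k, l) the order N (k + l) + k in t.  Up to degree k0 + l0 this orders the
indices by degree, then by k, and every higher degree comes after; so the term
of index (k0, l0) is the leading one as t tends to 0. *)
Lemma expansion0_lex d k0 l0 : has_expansion (0 : Cx2 R -> Cx R) d ->
  (forall k l, (k + l < k0 + l0)%N -> d (k, l) = 0) ->
  (forall k l, (k + l)%N = (k0 + l0)%N -> (k < k0)%N -> d (k, l) = 0) ->
  d (k0, l0) = 0.
Proof.
move=> d0 dlow dlex; have [C C0 dC] := expansion0_bound d0.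
pose n := (k0 + l0)%N; pose N := n.+1; pose w k l := (N * (k + l) + k)%N.
have wlt k l : (k, l) != (k0, l0) -> d (k, l) != 0 -> (w k0 l0 < w k l)%N.
  rewrite xpair_eqE => kl dkl; rewrite /w /N.
  case: (ltngtP (k + l)%N (k0 + l0)%N) => E.
  - by rewrite dlow// eqxx in dkl.
  - by rewrite -/n in E *; nia.
  - case: (ltngtP k k0) kl => F kl //=; first by rewrite dlex// eqxx in dkl.
    + by rewrite E; lia.
    + by subst k; have /eqP := kl; lia.
have key (t : R) : 0 < t -> t <= 1 -> nc (d (k0, l0)) * 8^-1 ^+ n <= (1 + 4 * C) * t.
  move=> t0 t1.
  pose z : Cx2 R := (((t ^+ N.+1 / 8)%:C)%C, ((t ^+ N / 8)%:C)%C).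
  have tN m : 0 <= t ^+ m / 8 < 1.
    have := exprn_ge0 m (ltW t0).
    have := exprn_ile1 m (ltW t0) t1; lra.
  pose x kl := d kl * monomial kl z.
  have nx k l : nc (x (k, l)) = nc (d (k, l)) * 8^-1 ^+ (k + l) * t ^+ w k l.
    rewrite /x ComplexField.Normc.normcM normc_monomial.
    rewrite -[z.1]/((t ^+ N.+1 / 8)%:C)%C -[z.2]/((t ^+ N / 8)%:C)%C.
    have /andP[? _] := tN N.+1; have /andP[? _] := tN N.
    have -> : t ^+ w k l = (t ^+ N.+1) ^+ k * (t ^+ N) ^+ l.
      by rewrite -!exprM -exprD; congr (_ ^+ _); rewrite /w; lia.
    rewrite !normc_real// -[(_, _).1]/k -[(_, _).2]/l (exprD 8^-1).
    move: (t ^+ N.+1) (t ^+ N) (nc _) => u v y; rewrite !exprMn.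
    move: (u ^+ k) (v ^+ l) (8^-1 ^+ k) (8^-1 ^+ l) => *; ring.
  have tw0 : 0 < t ^+ (w k0 l0).+1 by rewrite exprn_gt0.
  have [|A HA] := @cvg0_normc x _ _ tw0.
    have /andP[? ?] := tN N.+1; have /andP[? ?] := tN N.
    by apply: d0; exact: bidisc_real.
  have := HA _ (fsubsetUr [fset (k0, l0)] A)%fset.
  rewrite (big_fsetD1 (k0, l0))/=; last by rewrite !inE eqxx.
  set B := (_ `\ _)%fset; set S := \sum_(i <- B) _ => HS.
  have S4 : nc S <= 4 * C * t ^+ (w k0 l0).+1.
    apply: le_trans (normc_sum _ _) _.
    apply: (@le_trans _ _ (\sum_(kl <- B)
        C * t ^+ (w k0 l0).+1 * 4^-1 ^+ (kl.1 + kl.2))).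
      rewrite big_seq [leRHS]big_seq; apply: ler_sum => -[k l].
      rewrite !inE => /andP[kl _] /=.
      have [dkl|dkl] := eqVneq (d (k, l)) 0.
        rewrite /x dkl mul0r ComplexField.Normc.normc0.
        by rewrite mulr_ge0 ?exprn_ge0// mulr_ge0// ltW.
      rewrite nx.
      have H1 : t ^+ w k l <= t ^+ (w k0 l0).+1.
        by apply: ler_wiXn2l => //; [exact: ltW|exact: wlt].
      have H2 : nc (d (k, l)) * 8^-1 ^+ (k + l) <= C * 4^-1 ^+ (k + l).
        have -> : (4^-1 : R) ^+ (k + l) = 2 ^+ (k + l) * 8^-1 ^+ (k + l).
          by rewrite -exprMn; congr (_ ^+ _); field.
        by rewrite mulrA ler_wpM2r ?exprn_ge0// dC.
      rewrite [leRHS]mulrAC; apply: ler_pM => //.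
        by rewrite mulr_ge0 ?normc_ge0 ?exprn_ge0.
      by rewrite exprn_ge0// ltW.
    rewrite -mulr_sumr [leLHS]mulrC -[leRHS]mulrA ler_wpM2r ?mulr_ge0 ?(ltW tw0)//.
    exact: (sum_quarter_pow_le (fset_uniq B)).
  have : nc (x (k0, l0)) <= (1 + 4 * C) * t ^+ (w k0 l0).+1.
    rewrite -[x _](addrK S); apply: le_trans (le_normcD _ _) _.
    by rewrite normcN mulrDl mul1r lerD// ltW.
  by rewrite nx (exprS t (w k0 l0)) mulrA ler_pM2r// exprn_gt0.
apply: ComplexField.Normc.eq0_normc; apply/eqP; rewrite eq_le normc_ge0 andbT.
rewrite leNgt; apply/negP => y0.
set y := nc _ * 8^-1 ^+ n in key.
have {}y0 : 0 < y by rewrite mulr_gt0// exprn_gt0.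
pose K := 1 + 4 * C; have K0 : 0 < K by rewrite /K; lra.
have D0 : 0 < 2 * K + y by lra.
(* This value of t lies between 0 and 1 and makes K t smaller than y. *)
have := key (y / (2 * K + y)).
rewrite divr_gt0// ler_pdivrMr// mul1r => /(_ isT); rewrite -/K.
have -> : y <= 2 * K + y by lra.
move=> /(_ isT); rewrite mulrA ler_pdivlMr//; nra.
Qed.

Lemma expansion0 d : has_expansion (0 : Cx2 R -> Cx R) d -> d = 0.
Proof.
move=> d0; suff H n : forall k l, (k + l)%N = n -> d (k, l) = 0.
  by apply/funext => -[k l]; exact: (H (k + l)%N).
elim/ltn_ind: n => n IHn k; elim/ltn_ind: k => k IHk l kl.
apply: expansion0_lex => // [k' l'|k' l' E k'k].
  by rewrite kl => /IHn; exact.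
by apply: (IHk _ k'k); rewrite E.
Qed.

(** The value of [coefs] is chosen among all expansions of f, so it is known only
once the expansion is unique. *)
Lemma coefsE f a : has_expansion f a -> coefs f = a.
Proof.
move=> fa; rewrite /coefs; case: xgetP => [b _ fb|/(_ a)//].
have := has_expansionB fb fa; rewrite subrr => /expansion0 /eqP.
by rewrite subr_eq0 => /eqP.
Qed.

End Expansions.

(** * From arrays to functions *)
Section Cyclicity.
Variable R : realType.
Implicit Types (a b q : nat * nat -> Cx R) (f g : Cx2 R -> Cx R) (c : Cx R).
Implicit Type z : Cx2 R.

Definition polyp : Cx2 R -> Cx R := fun z => 2 - z.1 - z.2.

Lemma differentiable_fst z : differentiable (fst : Cx2 R -> Cx R) z.
Proof. by apply: linear_differentiable => y; exact: cvg_fst. Qed.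

Lemma differentiable_snd z : differentiable (snd : Cx2 R -> Cx R) z.
Proof. by apply: linear_differentiable => y; exact: cvg_snd. Qed.

Lemma differentiable_monomial kl z : differentiable (@monomial R kl) z.
Proof.
have diffX (f : Cx2 R -> Cx R) n : differentiable f z -> differentiable (f ^+ n) z.
  by case: n => [_|n]; [exact: differentiable_cst|exact: differentiableX].
have -> : @monomial R kl = (fst : Cx2 R -> Cx R) ^+ kl.1 * snd ^+ kl.2.
  by apply/funext => y; rewrite !exprfctE.
apply: differentiableM; apply: diffX; first exact: differentiable_fst.
exact: differentiable_snd.
Qed.

Lemma differentiable_polyp z : differentiable polyp z.
Proof.
apply: differentiableB; last exact: differentiable_snd.
by apply: differentiableB => //; exact: differentiable_fst.
Qed.

Lemma has_expansion_monomialM kl :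
  has_expansion (fun z => monomial kl z * polyp z) (mulp (delta R kl)).
Proof.
case: kl => k l.
have -> : (fun z => monomial (k, l) z * polyp z) =
    2 *: @monomial R (k, l) - @monomial R (k.+1, l) - @monomial R (k, l.+1).
  apply/funext => z; rewrite /polyp /monomial !fctE/= !exprS.
  by rewrite /GRing.scale/=; ring.
rewrite /mulp shift1_delta shift2_delta.
apply: has_expansionB; last exact: has_expansion_monomial.
apply: has_expansionB; last exact: has_expansion_monomial.
exact/has_expansionZ/has_expansion_monomial.
Qed.

Definition multiples : set (Cx2 R -> Cx R) :=
  linear_span [set g | exists kl, g = (fun z => monomial kl z * polyp z)].

Lemma holomorphic_multiple h : multiples h -> holomorphic_on (@bidisc R) h.
Proof.
move=> [n [c [g [gE ->]]]] z _.
have -> : (fun z => \sum_(i < n) c i * g i z) = \sum_(i < n) c i *: g i.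
  by apply/funext => y; rewrite fct_sumE.
apply: differentiable_sum => i; apply: differentiableZ.
have [kl ->] := gE i; apply: differentiableM.
  exact: differentiable_monomial.
exact: differentiable_polyp.
Qed.

Lemma finite_array_multiple q : finite_array q ->
  exists2 h, multiples h & has_expansion h (mulp q).
Proof.
move=> [s ->].
pose x0 : Cx R * (nat * nat) := (0, (0, 0)%N).
pose c (i : 'I_(size s)) : Cx R := (nth x0 s i).1.
pose kl (i : 'I_(size s)) := (nth x0 s i).2.
exists (fun z => \sum_(i < size s) c i * (monomial (kl i) z * polyp z)).
  by exists (size s), c, (fun i z => monomial (kl i) z * polyp z);
    split => // i; exists (kl i).
have -> : (fun z => \sum_(i < size s) c i * (monomial (kl i) z * polyp z)) =
    \sum_(x <- s) x.1 *: (fun z => monomial x.2 z * polyp z).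
  by apply/funext => z; rewrite fct_sumE (big_nth x0) big_mkord.
elim: s {c kl} => [|x s IH].
  rewrite !big_nil -(scale0r (delta R (0, 0)%N)) mulpZ.
  rewrite -[X in has_expansion X](scale0r (fun z => monomial (0, 0)%N z * polyp z)).
  exact/has_expansionZ/has_expansion_monomialM.
rewrite !big_cons mulpD mulpZ; apply: has_expansionD IH.
exact/has_expansionZ/has_expansion_monomialM.
Qed.

Lemma wnorm2_finite_array_lty (w : nat -> R) q : (forall n, 0 <= w n) ->
  finite_array q -> (wnorm2 w q < +oo)%E.
Proof.
move=> w0 [s ->]; elim: s => [|x s IH].
  by rewrite big_nil /wnorm2 esum1// => kl _; rewrite nsq0 mulr0.
rewrite big_cons; apply: le_lt_trans (wnorm2D_le _ _ w0) _.
apply: lte_add_pinfty; apply: lte_mul_pinfty => //.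
apply: le_lt_trans (wnorm2Z_le _ _ w0) _.
by rewrite wnorm2_delta// ltry.
Qed.

Lemma finite_array_mulp q : finite_array q -> finite_array (mulp q).
Proof.
move=> fq; apply: finite_arrayD; last exact/finite_arrayN/finite_array_shift2.
apply: finite_arrayD; last exact/finite_arrayN/finite_array_shift1.
exact: finite_arrayZ.
Qed.

(** The supremum that defines the norm is nearly attained on a finite set; the
restriction of a to it is a polynomial, and the error is the remaining tail. *)
Lemma finite_array_dense (w : nat -> R) a : (forall n, 0 <= w n) ->
  (wnorm2 w a < +oo)%E -> forall e : R, 0 < e ->
  exists q, finite_array q /\ (wnorm2 w (q - a)%R <= e%:E)%E.
Proof.
move=> w0 afin e e0.
pose F kl := (w (kl.1 + kl.2)%N * nsq (a kl))%:E.
have F0 kl : (0 <= F kl)%E by rewrite lee_fin mulr_ge0 ?nsq_ge0.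
have afn : wnorm2 w a \is a fin_num.
  by rewrite ge0_fin_numE// wnorm2_ge0.
have [_ [X [finX _] <-] HX] := ub_ereal_sup_adherent e0 afn.
have XF : (\sum_(kl \in X) F kl)%E = (\esum_(kl in X) F kl)%E.
  by rewrite esum_fset.
pose q := \sum_(kl <- fset_set X) a kl *: delta R kl.
exists q; split.
  by exists [seq (a kl, kl) | kl <- fset_set X]; rewrite big_map.
have qE kl : q kl = if kl \in X then a kl else 0.
  rewrite /q fct_sumE; have [klX|klX] := boolP (kl \in X).
    rewrite (big_fsetD1 kl)/=; last by rewrite in_fset_set.
    rewrite !fctE /delta eqxx /GRing.scale/= mulr1 big_seq big1 ?addr0// => i.
    rewrite !inE eq_sym => /andP[/negPf ne _].
    by rewrite -[LHS]/(a i * (kl == i)%:R) ne mulr0.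
  rewrite big_seq big1// => i; rewrite in_fset_set// => iX.
  rewrite scalrfctE /delta; have [E|] := eqVneq kl i; last by rewrite scaler0.
  by rewrite E iX in klX.
have -> : wnorm2 w (q - a) = (\esum_(kl in ~` X) F kl)%E.
  rewrite [RHS]esum_mkcond; apply: eq_esum => kl _.
  rewrite -[(q - a) kl]/(q kl - a kl) qE in_setC; case: (kl \in X) => /=.
    by rewrite subrr nsq0 mulr0.
  by rewrite sub0r nsqN.
have S1 : (0 <= \esum_(kl in X) F kl)%E by exact: esum_ge0.
have S2 : (0 <= \esum_(kl in ~` X) F kl)%E by exact: esum_ge0.
have aE : wnorm2 w a = (\esum_(kl in X) F kl + \esum_(kl in ~` X) F kl)%E.
  by rewrite /wnorm2 (esumID X) ?setTI// => kl _; exact: F0.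
have S1fin : (\esum_(kl in X) F kl)%E \is a fin_num.
  by rewrite ge0_fin_numE//; apply: le_lt_trans afin; rewrite aE leeDl.
move: HX; rewrite -/(esum setT _) -/(wnorm2 w a) XF lteBlDr// aE.
by rewrite lteD2lE// => /ltW.
Qed.

Definition dirichlet_weight (alpha : R) (n : nat) : R := n.+1%:R `^ alpha.

Lemma dirichlet_weight_ge0 alpha n : 0 <= dirichlet_weight alpha n.
Proof. exact: powR_ge0. Qed.

Lemma dirichlet_weight_le alpha n : alpha <= 2 ->
  dirichlet_weight alpha n <= quad_weight R n.
Proof.
move=> a2; rewrite /dirichlet_weight /quad_weight -powR_mulrn//.
by apply: ler_powR => //; rewrite ler1n.
Qed.

Lemma dirichlet_norm2E alpha f a : has_expansion f a ->
  dirichlet_norm2 alpha f = wnorm2 (dirichlet_weight alpha) a.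
Proof.
move=> fa; rewrite /dirichlet_norm2 (coefsE fa); apply: eq_esum => kl _.
by congr (_%:R `^ _ * _)%:E; exact: addn1.
Qed.

Lemma dirichlet_multiple alpha h q : finite_array q -> multiples h ->
  has_expansion h (mulp q) -> dirichlet alpha h.
Proof.
move=> fq mh hq; split; [exact: holomorphic_multiple|by exists (mulp q)|].
rewrite (dirichlet_norm2E _ hq); apply: wnorm2_finite_array_lty.
  exact: dirichlet_weight_ge0.
exact: finite_array_mulp.
Qed.

(** The value e / 2 turns a large inequality on squares into a strict one on
norms. *)
Lemma dirichlet_norm_lt alpha f a (e : R) : has_expansion f a -> 0 < e ->
  (wnorm2 (dirichlet_weight alpha) a <= ((e / 2) ^+ 2)%:E)%E ->
  (dirichlet_norm alpha f < e%:E)%E.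
Proof.
move=> fa e0 ae; rewrite /dirichlet_norm (dirichlet_norm2E _ fa).
have e2 : ((e / 2) ^+ 2) `^ 2^-1 = e / 2.
  by rewrite powR12_sqrt ?sqr_ge0// sqrtr_sqr ger0_norm// ltW// divr_gt0.
apply: (@le_lt_trans _ _ (((e / 2) ^+ 2)%:E `^ 2^-1)%E).
  apply: gt0_ler_poweR => //.
    by rewrite in_itv/= leey wnorm2_ge0//; exact: dirichlet_weight_ge0.
  by rewrite in_itv/= leey lee_fin sqr_ge0.
by rewrite poweR_EFin e2 lte_fin ltr_pdivrMr// ltr_pMr// ltr1n.
Qed.

(** First truncate the expansion of g to a polynomial, then approximate that
polynomial by a multiple of p for the larger critical weight. *)
Lemma multiples_dense alpha g (e : R) : alpha <= 2 -> dirichlet alpha g -> 0 < e ->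
  exists h, [/\ multiples h, dirichlet alpha h &
    (dirichlet_norm alpha (fun z => h z - g z)%R < e%:E)%E].
Proof.
move=> a2 [_ [a ga] gfin] e0; rewrite (dirichlet_norm2E _ ga) in gfin.
pose e4 := (e / 2) ^+ 2 / 4.
have e40 : 0 < e4 by rewrite /e4 divr_gt0// exprn_gt0// divr_gt0.
have w0 := dirichlet_weight_ge0 alpha.
have [b [fb ba]] := finite_array_dense w0 gfin e40.
have [q [fq qb]] := approximable_finite_array fb e40.
have [h mh hq] := finite_array_multiple fq.
exists h; split => //; first exact: dirichlet_multiple hq.
apply: (dirichlet_norm_lt (has_expansionB hq ga)) => //.
rewrite -(subrKA b); apply: le_trans (wnorm2D_le _ _ w0) _.
have -> : ((e / 2) ^+ 2)%:E = (2%:E * e4%:E + 2%:E * e4%:E)%E.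
  by rewrite -!EFinM -EFinD /e4; congr _%:E; field.
apply: leeD; apply: lee_wpmul2l => //.
apply: le_trans qb; apply: le_wnorm2 => n; exact: dirichlet_weight_le.
Qed.

Lemma dirichlet_polyp alpha : dirichlet alpha polyp.
Proof.
have pE : (fun z => monomial (0, 0)%N z * polyp z) = polyp.
  by apply/funext => z; rewrite /monomial/= !expr0 !mul1r.
apply: (@dirichlet_multiple _ _ (delta R (0, 0)%N)).
- exact: finite_array_delta.
- exists 1%N, (fun=> 1), (fun=> polyp); split.
    by move=> _; exists (0, 0)%N; rewrite pE.
  by apply/funext => z; rewrite big_ord1 mul1r.
- by rewrite -[X in has_expansion X]pE; exact: has_expansion_monomialM.
Qed.

End Cyclicity.

Theorem theorem3p1 (R : realType) (alpha : R) (halpha : alpha <= 2) :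
  is_cyclic alpha (fun z : Cx2 R => 2 - z.1 - z.2).
Proof.
split; first exact: dirichlet_polyp.
apply/seteqP; split => [g []//|g Dg]; split => // e e0.
exact: multiples_dense.
Qed.
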